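(* Let $\mathcal{D}_1\subseteq\mathbb{R}$ be connected, let $\mathcal{D}_2\subset\mathbb{R}^N$ be compact, and let $g:\mathcal{D}_1\times\mathcal{D}_2\to\mathbb{R}$ be continuously differentiable. Let $f(\varepsilon)=\max_{x\in\mathcal{D}_2} g(\varepsilon,x)$, and let $\varepsilon_{\mathrm{lb}},\varepsilon_0\in\mathcal{D}_1$ with $\varepsilon_{\mathrm{lb}}<\varepsilon_0$ and $x_0\in\mathcal{D}_2$ satisfy $f(\varepsilon_{\mathrm{lb}})<0\le g(\varepsilon_0,x_0)\le f(\varepsilon_0)$. Let $\{\varepsilon_k\}$ and $\{x_k\}$ be the sequences generated from this data by the Hybrid Expansion-Contraction (HEC) algorithm described in the context, with subroutines satisfying the subroutine assumptions in the context, and let $\tilde\varepsilon=\lim_{k\to\infty}\varepsilon_k$. Suppose additionally that $\{x_k\}$ has only a single cluster point $\tilde x$, that $\tilde x$ lies on an open continuous path $x_{\mathrm p}:\mathcal{D}_1\to\mathcal{D}_2$ of stationary points of $g_\varepsilon$ as $\varepsilon$ varies, with $\tilde x=x_{\mathrm p}(\tilde\varepsilon)$, and that HEC eventually only encounters this path, i.e., $x_k=x_{\mathrm p}(\varepsilon_k)$ for all sufficiently large $k$. If $g$ and $x_{\mathrm p}$ are twice continuously differentiable at $(\tilde\varepsilon,\tilde x)$ and at $\tilde\varepsilon$, respectively, $\tilde x$ is a local maximizer of $g_{\tilde\varepsilon}$, and $g_{\tilde x}'(\tilde\varepsilon)\neq 0$, then the sequence $\{\varepsilon_k\}$ converges Q-quadratically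 to $\tilde\varepsilon$.
   Context: Notation: for fixed $x\in\mathcal{D}_2$, $g_x(\varepsilon):=g(\varepsilon,x)$ on $\mathcal{D}_1$; for fixed $\varepsilon\in\mathcal{D}_1$, $g_\varepsilon(x):=g(\varepsilon,x)$ on $\mathcal{D}_2$. A stationary point of $g_\varepsilon$ is a point $x$ with $\nabla g_\varepsilon(x)=0$. A pair $(\tilde\varepsilon,\tilde x)$ is a pseudoroot if $g(\tilde\varepsilon,\tilde x)=0$ and $\tilde x$ is a stationary point of $g_{\tilde\varepsilon}$. HEC algorithm. Input: $\varepsilon_{\mathrm{lb}},\varepsilon_0,x_0$ as in the claim. For $k=0,1,2,\dots$: (1) Contraction: compute $\hat\varepsilon_k\in(\varepsilon_{\mathrm{lb}},\varepsilon_k]$ with $g_{x_k}(\hat\varepsilon_k)=0$, using the root-finding subroutine initialized at $\varepsilon_k$ (such a root exists since $g_{x_k}(\varepsilon_{\mathrm{lb}})<0\le g_{x_k}(\varepsilon_k)$; if $g_{x_k}(\varepsilon_k)=0$, then $\hat\varepsilon_k=\varepsilon_k$ is returned). (2) If $x_k$ is a stationary point of $g_{\hat\varepsilon_k}$, return $(\tilde\varepsilon,\tilde x)=(\hat\varepsilon_k,x_k)$ and stop. (3) Expansion: compute a stationary point $x_{k+1}\in\mathcal{D}_2$ of $g_{\hat\varepsilon_k}$ with $g_{\hat\varepsilon_k}(x_{k+1})>g_{\hat\varepsilon_k}(x_k)$, using the optimization subroutine initialized at $x_k$. (4) Set $\varepsilon_{k+1}:=\hat\varepsilon_k$. The statement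 concerns the case where HEC does not terminate, so that infinite sequences are produced. In that case $\{\varepsilon_k\}$ is monotonically decreasing and convergent, and $(\tilde\varepsilon,\tilde x)$ is a pseudoroot for every cluster point $\tilde x$ of $\{x_k\}$. Subroutine assumptions: both subroutines are deterministic (same output for same initial data) and converge exactly (exact roots; exact stationary points, i.e., zero gradient); the root-finding method uses bracketing to ensure convergence to a root in the given bracket; the optimization solver is monotonic, i.e., it always increases the objective value at successive iterates until it reaches a stationary point. Q-quadratic convergence of $\{\varepsilon_k\}$ to $\tilde\varepsilon$ means: $\varepsilon_k\to\tilde\varepsilon$ and there is a constant $M>0$ with $|\varepsilon_{k+1}-\tilde\varepsilon|\le M|\varepsilon_k-\tilde\varepsilon|^2$ for all sufficiently large $k$. ''Twice continuously differentiable at a point'' means twice continuously differentiable in a neighborhood of that point. *)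

(* Defs.v *)
From mathcomp Require Import all_boot all_order all_algebra.
From mathcomp Require Import all_classical all_reals all_analysis.

Set Implicit Arguments.
Unset Strict Implicit.
Unset Printing Implicit Defensive.

Import Order.TTheory GRing.Theory Num.Theory.
Import numFieldNormedType.Exports.

Local Open Scope classical_set_scope.
Local Open Scope ring_scope.

(* In finite dimension, continuity of the derivative in the operator norm is
   the same as continuity of q |-> 'd f q v for each fixed v. *)
Definition C1_on (R : realType) (V W : normedModType R)
    (f : V -> W) (U : set V) : Prop :=
  forall q, U q ->
    differentiable f q /\ forall v : V, {for q, continuous (fun r => 'd f r v)}.

Definition C2_on (R : realType) (V W : normedModType R)
    (f : V -> W) (U : set V) : Prop :=
  C1_on f U /\ forall v : V, C1_on (fun q => 'd f q v) U.

Definition C2_at (R : realType) (V W : normedModType R)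
    (f : V -> W) (p : V) : Prop :=
  exists2 U : set V, open_nbhs p U & C2_on f U.

(* The usual convention for a function which is continuously differentiable on
   an arbitrary (not necessarily open) set: f is defined on the ambient space
   and is C^1 on some open set containing A. *)
Definition C1_around (R : realType) (V W : normedModType R)
    (f : V -> W) (A : set V) : Prop :=
  exists U : set V, [/\ open U, A `<=` U & C1_on f U].

Definition gradient (R : realType) (N : nat) (h : 'rV[R]_N -> R)
    (x : 'rV[R]_N) : 'rV[R]_N :=
  \row_i 'D_('e_i : 'rV[R]_N) h x.

Definition stationary (R : realType) (N : nat) (h : 'rV[R]_N -> R)
    (x : 'rV[R]_N) : Prop :=
  gradient h x = 0.

Definition local_maximizer (R : realType) (T : topologicalType) (D : set T)
    (h : T -> R) (x : T) : Prop :=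
  D x /\ \forall y \near within D (nbhs x), h y <= h x.

Definition is_max (R : realType) (A : set R) (m : R) : Prop :=
  A m /\ ubound A m.

(* g_x and g_eps *)
Definition fix_x (R : realType) (N : nat) (g : R * 'rV[R]_N -> R)
    (x : 'rV[R]_N) : R -> R := fun e => g (e, x).

Definition fix_eps (R : realType) (N : nat) (g : R * 'rV[R]_N -> R)
    (e : R) : 'rV[R]_N -> R := fun x => g (e, x).

(* Subroutines are deterministic, i.e. functions of their input data.
   A root finder receives the function, the lower end of the bracket and the
   initial point, which is also the upper end of the bracket; it returns a
   root. *)
Definition root_finder (R : realType) := (R -> R) -> R -> R -> R.

Definition exact_bracketing (R : realType) (rootf : root_finder R) : Prop :=
  forall (h : R -> R) (a b : R), a < b -> {within `[a, b], continuous h} ->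
    h a < 0 -> 0 <= h b ->
    [/\ a < rootf h a b <= b, h (rootf h a b) = 0
      & h b = 0 -> rootf h a b = b].

(* An optimization solver receives the objective and the initial point; it
   generates a sequence of iterates, whose limit is its output.  A solver that
   stops after finitely many iterations repeats its last iterate. *)
Definition optimizer (R : realType) (N : nat) :=
  ('rV[R]_N -> R) -> 'rV[R]_N -> nat -> 'rV[R]_N.

Definition opt_output (R : realType) (N : nat) (opt : optimizer R N)
    (h : 'rV[R]_N -> R) (y : 'rV[R]_N) : 'rV[R]_N :=
  lim (opt h y @ \oo).

(* The call of opt on h from y is monotonic and converges exactly.  This is
   stated for one call, not for all inputs, because h need not have a
   stationary point in D above the level h y. *)
Record exact_monotonic_call (R : realType) (N : nat) (D : set 'rV[R]_N)
    (opt : optimizer R N) (h : 'rV[R]_N -> R) (y : 'rV[R]_N) : Prop := {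
  emc_init : opt h y 0%N = y;
  emc_dom : forall j, D (opt h y j);
  emc_increase : forall j, ~ stationary h (opt h y j) ->
    h (opt h y j) < h (opt h y j.+1);
  emc_stop : forall j, stationary h (opt h y j) ->
    opt h y j.+1 = opt h y j;
  emc_cvg : cvg (opt h y @ \oo);
  emc_exact : stationary h (opt_output opt h y)
}.

(* (eps, ehat, x) are the infinite sequences produced by a nonterminating run
   of hybrid expansion-contraction; ehat k is the contraction of eps k. *)
Record HEC_run (R : realType) (N : nat) (g : R * 'rV[R]_N -> R)
    (D2 : set 'rV[R]_N) (rootf : root_finder R) (opt : optimizer R N)
    (elb e0 : R) (x0 : 'rV[R]_N)
    (eps ehat : nat -> R) (x : nat -> 'rV[R]_N) : Prop := {
  hec_eps0 : eps 0%N = e0;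
  hec_x0 : x 0%N = x0;
  hec_contraction : forall k, ehat k = rootf (fix_x g (x k)) elb (eps k);
  hec_contraction_root : forall k,
    elb < ehat k <= eps k /\ fix_x g (x k) (ehat k) = 0;
  hec_continue : forall k, ~ stationary (fix_eps g (ehat k)) (x k);
  hec_expansion : forall k,
    x k.+1 = opt_output opt (fix_eps g (ehat k)) (x k);
  hec_expansion_stationary : forall k,
    [/\ D2 (x k.+1), stationary (fix_eps g (ehat k)) (x k.+1)
      & fix_eps g (ehat k) (x k) < fix_eps g (ehat k) (x k.+1)];
  hec_update : forall k, eps k.+1 = ehat k
}.

Definition Q_quadratic (R : realType) (u : nat -> R) (l : R) : Prop :=
  (u @ \oo --> l) /\
  exists2 M : R, 0 < M &
    \forall k \near \oo, `|u k.+1 - l| <= M * `|u k - l| ^+ 2.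

(* Main.v *)
Require Import Defs.
From mathcomp Require Import all_boot all_order all_algebra.
From mathcomp Require Import all_classical all_reals all_analysis.
From mathcomp Require Import lra.
Import Order.TTheory GRing.Theory Num.Theory.
Import numFieldNormedType.Exports.
Local Open Scope classical_set_scope.
Local Open Scope ring_scope.

Set Implicit Arguments.
Unset Strict Implicit.

(** Write [q_k = (eps k.+1, x k)].  The contraction step says that [g q_k = 0],
    and [q_k] tends to [(et, xt)].  Compare [q_k] with the point [(et, x k)],
    which differs from it only in the first coordinate and from [(et, xt)] only
    in the second.

    - Moving in the first coordinate, [g] changes at least linearly, because its
      partial derivative there is nonzero at [(et, xt)] and hence bounded away
      from zero nearby ([dist_ge_of_partial_neq0]):
      [d * |eps k.+1 - et| <= |g q_k - g (et, x k)| = |g (et, x k)|].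

    - Moving in the second coordinate, [g] changes at most quadratically, as
      [xt] is a stationary point of [fix_eps g et] and the differential of [g]
      varies at most linearly around [(et, xt)] ([stationary_quadratic_bound]).  By continuity
      [g (et, xt) = 0], so [|g (et, x k)| <= C * |x k - xt| ^ 2].

    Finally [x k = xp (eps k)] and [xp] is differentiable at [et], so that
    [|x k - xt| <= L * |eps k - et|] ([differentiable_dist_le]).  Together
    [|eps k.+1 - et| <= (C * L ^ 2 / d) * |eps k - et| ^ 2].

    Both estimates on [g] come from the mean value theorem along a segment
    ([mean_value_segment]). *)

Definition C1_at (R : realType) (V W : normedModType R)
    (f : V -> W) (p : V) : Prop :=
  exists2 U : set V, open_nbhs p U & C1_on f U.

(** The one-variable mean value theorem for [t |-> g (a + t *: v)], whose
    derivative is the differential of [g] applied to [v]. *)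
Lemma mean_value_segment (R : realType) (V : normedModType R)
    (g : V -> R) (a v : V) :
  (forall t : R, 0 <= t <= 1 -> differentiable g (a + t *: v)) ->
  exists2 t : R, 0 <= t <= 1 & g (a + v) - g a = 'd g (a + t *: v) v.
Proof.
move=> dg; pose phi (t : R) := g (a + t *: v).
(* The difference quotients of phi at t are those of g along v, so both
   differentiability and the value of the derivative transfer. *)
have quotE (t : R) :
    (fun h : R => h^-1 *: ((phi \o shift t) (h *: 1) - phi t)) =
    (fun h => h^-1 *: ((g \o shift (a + t *: v)) (h *: v) - g (a + t *: v))).
  apply/funext => h.
  by rewrite /phi /= scalerDl -!scalerA scale1r addrCA.
have phi' (t : R) : 0 <= t <= 1 -> is_derive t 1 phi ('d g (a + t *: v) v).
  move=> t01; have dgt := dg t t01; apply: DeriveDef.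
    by have := @diff_derivable _ _ _ _ _ v dgt; rewrite /derivable -quotE.
  by rewrite -(deriveE v dgt) /derive quotE.
have [||t t01] := @MVT_segment R phi (fun t => 'd g (a + t *: v) v) 0 1 ler01.
- move=> t; rewrite in_itv/= => /andP[t0 t1].
  by apply: phi'; rewrite !ltW.
- apply: (@derivable_within_continuous _ _ phi `[0, 1]) => t.
  rewrite in_itv/= => t01.
  by have [] := phi' t t01.
by rewrite /phi scale1r scale0r addr0 subr0 mulr1 => ?; exists t.
Qed.

Lemma prod_norm0l (R : realType) (V W : normedModType R) (w : W) :
  `|(0 : V, w)| = `|w|.
Proof. by rewrite prod_normE /= normr0; apply/max_idPr. Qed.

Lemma entry_le_norm (R : realType) (m n : nat) (A : 'M[R]_(m, n)) i j :
  `|A i j| <= `|A|.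
Proof.
rewrite [leRHS]/Num.Def.normr /= mx_normrE.
by apply/bigmax_geP; right => /=; exists (i, j).
Qed.

(** Near [p] the increment of [f] is its differential, which is a bounded linear
    map, plus a remainder bounded by the norm of the displacement. *)
Lemma differentiable_dist_le (R : realType) (V W : normedModType R)
    (f : V -> W) (p : V) :
  differentiable f p ->
  exists2 C : R, 0 < C & \forall q \near p, `|f q - f p| <= C * `|q - p|.
Proof.
move=> df.
have [k k0 dk] := linear_lipschitz (diff_continuous df).
exists (k + 1); first by rewrite addr_gt0.
have := diff_locallyx df; set o := 'o_ _ => fE.
have /nbhs_norm0P[r r0 oP] : \forall h \near 0, `|o id h| <= 1 * `|h|.
  exact: littleoP ltr01.
apply/nbhs_normP; exists r => // q /=; rewrite distrC => qr.
rewrite -{1}(subrK p q) fE -(addrA (f p)) addrAC subrr add0r.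
by rewrite mulrDl (le_trans (ler_normD _ _))// lerD//; exact: oP.
Qed.

Lemma partial_diff_right (R : realType) (N : nat) (g : R * 'rV[R]_N -> R)
    (e : R) (y : 'rV[R]_N) (w : 'rV[R]_N) :
  differentiable g (e, y) -> 'D_w (fix_eps g e) y = 'd g (e, y) (0, w).
Proof.
move=> dg; rewrite -(deriveE _ dg) /derive.
suff -> : (fun h : R =>
      h^-1 *: ((fix_eps g e \o shift y) (h *: w) - fix_eps g e y)) =
    (fun h => h^-1 *: ((g \o shift (e, y)) (h *: (0, w)) - g (e, y))) by [].
apply/funext => h; congr (_ *: (g (_, _) - _)).
by rewrite /= scaler0 add0r.
Qed.

Lemma partial_diff_left (R : realType) (N : nat) (g : R * 'rV[R]_N -> R)
    (e : R) (y : 'rV[R]_N) :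
  differentiable g (e, y) -> derive1 (fix_x g y) e = 'd g (e, y) (1, 0).
Proof.
move=> dg; rewrite derive1E -(deriveE _ dg) /derive.
suff -> : (fun h : R =>
      h^-1 *: ((fix_x g y \o shift e) (h *: 1) - fix_x g y e)) =
    (fun h => h^-1 *: ((g \o shift (e, y)) (h *: (1, 0)) - g (e, y))) by [].
apply/funext => h; congr (_ *: (g (_, _) - _)).
by rewrite /= scaler0 add0r.
Qed.

(** By continuity the partial derivative keeps at least half of its absolute
    value near [p]; the mean value theorem along the horizontal segment from
    [(p.1, q.2)] to [q] then bounds the increment from below. *)
Lemma dist_ge_of_partial_neq0 (R : realType) (V : normedModType R)
    (g : R * V -> R) (p : R * V) :
  C1_at g p -> 'd g p (1, 0) != 0 ->
  exists2 d : R, 0 < d &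
    \forall q \near p, d * `|q.1 - p.1| <= `|g q - g (p.1, q.2)|.
Proof.
move=> [U Up gU] c0; set c := 'd g p (1, 0) in c0.
have c20 : 0 < `|c| / 2 by rewrite divr_gt0// normr_gt0.
exists (`|c| / 2) => //.
have [dgp /(_ (1, 0)) dgc] := gU p (nbhs_singleton (open_nbhs_nbhs Up)).
have near_p : \forall q \near p,
    differentiable g q /\ `|c| / 2 <= `|'d g q (1, 0)|.
  near=> q; split.
    suff /gU[] : U q by [].
    by near: q; exact: open_nbhs_nbhs.
  have : `|c - 'd g q (1, 0)| < `|c| / 2.
    by near: q; move/cvgrPdist_lt: dgc; exact.
  have := ler_normD (c - 'd g q (1, 0)) ('d g q (1, 0)).
  by rewrite subrK; lra.
have /nbhs_normP[r r0 pr] := near_p.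
apply/nbhs_normP; exists r => // -[s y] /= qr.
have segE (t : R) : (p.1, y) + t *: (s - p.1, 0) = (p.1 + t * (s - p.1), y).
  by congr (_, _); rewrite /= scaler0 addr0.
(* The segment stays in the ball of radius r, as the norm is the maximum of
   the norms of the two coordinates. *)
have {}pr (t : R) : 0 <= t <= 1 ->
    differentiable g ((p.1, y) + t *: (s - p.1, 0)) /\
    `|c| / 2 <= `|'d g ((p.1, y) + t *: (s - p.1, 0)) (1, 0)|.
  move=> /andP[t0 t1]; apply: pr; rewrite segE /=.
  apply: le_lt_trans qr; rewrite distrC [leRHS]distrC !prod_normE /=.
  rewrite addrAC subrr add0r normrM (ger0_norm t0).
  by rewrite ge_max !le_max lexx orbT andbT ler_piMl.
have [t t01|t t01] := @mean_value_segment R _ g (p.1, y) (s - p.1, 0).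
  by have [] := pr t t01.
have -> : (p.1, y) + (s - p.1, 0) = (s, y).
  by congr (_, _); rewrite /= ?addr0// addrC subrK.
move=> ->.
have [_] := pr t t01; move: (_ + t *: _) => z dz.
have -> : ((s - p.1, 0) : R * V) = (s - p.1) *: (1, 0).
  by congr (_, _); rewrite /= ?scaler0// /GRing.scale /= mulr1.
by rewrite linearZ normrM mulrC ler_wpM2l.
Unshelve. all: by end_near. Qed.

Lemma linear_pair0 (R : realType) (N : nat)
    (l : {linear (R * 'rV[R]_N)%type -> R}) (w : 'rV[R]_N) :
  l (0, w) = \sum_i w 0 i * l (0, 'e_i).
Proof.
have -> : (0 : R, w) = \sum_i w 0 i *: ((0, 'e_i) : (R * 'rV[R]_N)%type).
  rewrite [LHS](_ : _ = (0, \sum_i w 0 i *: 'e_i));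
    last by rewrite -row_sum_delta.
  elim/big_rec2 : _ => //= i _ v _ <-.
  by congr (_, _); rewrite /= scaler0 addr0.
by rewrite linear_sum; apply: eq_bigr => i _; rewrite linearZ.
Qed.

(** The hypothesis gives differentiability of [q |-> 'd g q v] at [p] for each
    fixed [v] only.  In finite dimension the finitely many vectors of a basis
    suffice for a bound that is uniform in the direction [w]. *)
Lemma partial_diff_dist_le (R : realType) (N : nat) (g : R * 'rV[R]_N -> R)
    (p : R * 'rV[R]_N) :
  C2_at g p ->
  exists2 C : R, 0 < C & \forall q \near p, forall w : 'rV[R]_N,
    `|'d g q (0, w) - 'd g p (0, w)| <= C * `|q - p| * `|w|.
Proof.
move=> [U Up [_ gU]].
have pU := nbhs_singleton (open_nbhs_nbhs Up).
have /choice[C CP] (i : 'I_N) : exists C : R, 0 < C /\ \forall q \near p,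
    `|'d g q (0, 'e_i) - 'd g p (0, 'e_i)| <= C * `|q - p|.
  have [dg _] := gU (0, 'e_i) p pU.
  by have [C] := differentiable_dist_le dg; exists C.
exists (1 + \sum_i C i).
  by rewrite ltr_pwDl// sumr_ge0// => i _; have [/ltW] := CP i.
near=> q.
have qC (i : 'I_N) : `|'d g q (0, 'e_i) - 'd g p (0, 'e_i)| <= C i * `|q - p|.
  by move: i; near: q; apply: filter_forall => i; have [] := CP i.
move=> w.
have dE (r : R * 'rV[R]_N) : 'd g r (0, w) = \sum_i w 0 i * 'd g r (0, 'e_i).
  exact: linear_pair0.
rewrite [X in `|X - _|]dE [X in `|_ - X|]dE -sumrB.
rewrite (le_trans (ler_norm_sum _ _ _))//.
apply: (@le_trans _ _ (\sum_i C i * `|q - p| * `|w|)).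
  apply: ler_sum => i _; rewrite -mulrBr normrM mulrC.
  by rewrite ler_pM// entry_le_norm.
by rewrite -!mulr_suml ler_wpM2r// ler_wpM2r// lerDr.
Unshelve. all: by end_near. Qed.

(** The partial differential vanishes at [(e, x)], hence it is of order
    [|y - x|] on the segment from [(e, x)] to [(e, y)]; the mean value theorem
    multiplies it by the displacement [y - x]. *)
Lemma stationary_quadratic_bound (R : realType) (N : nat)
    (g : R * 'rV[R]_N -> R) (e : R) (x : 'rV[R]_N) :
  C2_at g (e, x) -> stationary (fix_eps g e) x ->
  exists2 C : R, 0 < C &
    \forall y \near x, `|g (e, y) - g (e, x)| <= C * `|y - x| ^+ 2.
Proof.
move=> g2 gx0; have [C C0 dgC] := partial_diff_dist_le g2.
exists C => //; have [U Up [gU _]] := g2.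
have dg0 w : 'd g (e, x) (0, w) = 0.
  have [dg _] := gU _ (nbhs_singleton (open_nbhs_nbhs Up)).
  rewrite linear_pair0 big1// => i _; rewrite -partial_diff_right//.
  by have /rowP/(_ i) := gx0; rewrite !mxE => ->; rewrite mulr0.
have /nbhs_normP[r r0 pr] : \forall q \near (e, x), U q /\
    forall w, `|'d g q (0, w) - 'd g (e, x) (0, w)| <= C * `|q - (e, x)| * `|w|.
  by apply: filterI dgC; exact: open_nbhs_nbhs.
apply/nbhs_normP; exists r => // y /= yr; pose v := y - x.
have segE (t : R) : (e, x) + t *: (0, v) = (e, x + t *: v).
  by congr (_, _); rewrite /= scaler0 addr0.
have distE (t : R) : 0 <= t -> `|((e, x) + t *: (0, v)) - (e, x)| = t * `|v|.
  move=> t0; rewrite addrAC subrr add0r normrZ ger0_norm//.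
  by rewrite prod_norm0l.
have {}pr (t : R) : 0 <= t <= 1 -> U ((e, x) + t *: (0, v)) /\
    forall w, `|'d g ((e, x) + t *: (0, v)) (0, w) - 'd g (e, x) (0, w)| <=
      C * `|((e, x) + t *: (0, v)) - (e, x)| * `|w|.
  move=> /andP[t0 t1]; apply: pr => /=.
  rewrite distrC distE//; apply: le_lt_trans yr.
  by rewrite distrC ler_piMl.
have [t t01|t t01] := @mean_value_segment R _ g (e, x) (0, v).
  by have [/gU[]] := pr t t01.
have -> : (e, x) + (0, v) = (e, y).
  by congr (_, _); rewrite /= ?addr0// addrC subrK.
move=> ->; have [_ /(_ v)] := pr t t01.
rewrite [X in `|_ - X|]dg0 subr0 => /le_trans; apply.
have /andP[t0 t1] := t01.
by rewrite distE// expr2 -mulrA ler_wpM2l ?(ltW C0)// ler_wpM2r// ler_piMl.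
Qed.

Unset Implicit Arguments.
Set Strict Implicit.

Theorem theorem3p10 (R : realType) (N : nat)
    (D1 : set R) (D2 : set 'rV[R]_N) (g : R * 'rV[R]_N -> R) (f : R -> R)
    (elb e0 : R) (x0 : 'rV[R]_N)
    (rootf : root_finder R) (opt : optimizer R N)
    (eps ehat : nat -> R) (x : nat -> 'rV[R]_N)
    (et : R) (xt : 'rV[R]_N) (xp : R -> 'rV[R]_N)
    (hD1 : connected D1)
    (hD2 : compact D2)
    (hg : C1_around g (D1 `*` D2))
    (hf : forall e, D1 e -> is_max [set fix_eps g e y | y in D2] (f e))
    (helb : D1 elb) (he0 : D1 e0) (hlt : elb < e0) (hx0 : D2 x0)
    (hflb : f elb < 0) (hg0 : 0 <= g (e0, x0)) (hf0 : g (e0, x0) <= f e0)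
    (hrootf : exact_bracketing rootf)
    (hrun : HEC_run g D2 rootf opt elb e0 x0 eps ehat x)
    (hopt : forall k,
      exact_monotonic_call D2 opt (fix_eps g (ehat k)) (x k))
    (het : et = lim (eps @ \oo))
    (hxt : cluster (x @ \oo) = [set xt])
    (hxp_dom : forall e, D1 e -> D2 (xp e))
    (hxp_cont : {within D1, continuous xp})
    (hxp_stat : forall e, D1 e -> stationary (fix_eps g e) (xp e))
    (hxp_xt : xt = xp et)
    (hxp_ev : \forall k \near \oo, x k = xp (eps k))
    (hg2 : C2_at g (et, xt))
    (hxp2 : C2_at xp et)
    (hmax : local_maximizer D2 (fix_eps g et) xt)
    (hder : derive1 (fix_x g xt) et != 0) :
  Q_quadratic eps et.
Proof.
have epsS k : eps k.+1 = ehat k by case: hrun.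
have contr k : elb < eps k.+1 <= eps k /\ g (eps k.+1, x k) = 0.
  by rewrite epsS; case: hrun => _ _ _ /(_ k).
have eps_noninc : nonincreasing_seq eps.
  by apply/nonincreasing_seqP => k; have [/andP[]] := contr k.
have eps_gt k : elb < eps k.
  by case: k => [|k]; [case: hrun => ->|have [/andP[]] := contr k].
have eps_cvg : eps @ \oo --> et.
  rewrite het; apply: nonincreasing_is_cvgn => //.
  by exists elb => _ [k _ <-]; exact/ltW.
have eps_is_cvg : cvg (eps @ \oo) by apply/cvg_ex; exists et.
(* Stationarity along xp is available on D1 only.  The limit is in D1 because
   it lies between elb and e0, and the connected set D1 is an interval. *)
have D1et : D1 et.
  move/connected_intervalP: hD1 => /(_ _ _ helb he0); apply; apply/andP; split.
    by rewrite het; apply: limr_ge; [|near=> k; exact/ltW].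
  have <- : eps 0%N = e0 by case: hrun.
  by rewrite het; apply: nonincreasing_cvgn_ge.
have xp_diff : differentiable xp et.
  case: hxp2 => U /open_nbhs_nbhs /nbhs_singleton Uet [xpU _].
  by have [] := xpU et Uet.
have x_cvg : x @ \oo --> xt.
  rewrite hxp_xt.
  apply: (@cvg_trans _ ((xp \o eps) @ \oo)).
    by apply: near_eq_cvg; near=> k; apply/esym; near: k; exact: hxp_ev.
  apply: (cvg_comp _ _ eps_cvg); exact: (differentiable_continuous xp_diff).
have eps1_cvg : (fun k => eps k.+1) @ \oo --> et by rewrite (cvg_shiftS eps).
have gC1 : C1_at g (et, xt) by case: hg2 => U pU [gU _]; exists U.
have dg : differentiable g (et, xt).
  case: gC1 => U /open_nbhs_nbhs /nbhs_singleton Up gU.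
  by have [] := gU _ Up.
have [d d0 dP] : exists2 d : R, 0 < d &
    \forall q \near (et, xt), d * `|q.1 - et| <= `|g q - g (et, q.2)|.
  by apply: (dist_ge_of_partial_neq0 gC1); rewrite -partial_diff_left.
have xt_stat : stationary (fix_eps g et) xt by rewrite hxp_xt; exact: hxp_stat.
have [C C0 CP] := stationary_quadratic_bound hg2 xt_stat.
have [L L0 LP] := differentiable_dist_le xp_diff.
have q_cvg : (fun k => (eps k.+1, x k)) @ \oo --> (et, xt).
  exact: (cvg_pair eps1_cvg x_cvg).
have gt0 : g (et, xt) = 0.
  have gcvg : (fun k => g (eps k.+1, x k)) @ \oo --> g (et, xt).
    by apply: (cvg_comp _ _ q_cvg); exact: (differentiable_continuous dg).
  rewrite -(cvg_lim (@Rhausdorff R) gcvg).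
  under eq_fun do rewrite (contr _).2.
  exact: lim_cst.
split => //; exists (d^-1 * (C * L ^+ 2)).
  by rewrite !mulr_gt0// ?invr_gt0// exprn_gt0.
near=> k.
rewrite -mulrA ler_pdivlMl//.
have dk : d * `|eps k.+1 - et| <= `|g (eps k.+1, x k) - g (et, x k)|.
  by near: k; exact: (q_cvg _ dP).
have Ck : `|g (et, x k) - g (et, xt)| <= C * `|x k - xt| ^+ 2.
  by near: k; exact: (x_cvg _ CP).
have Lk : `|xp (eps k) - xp et| <= L * `|eps k - et|.
  by near: k; exact: (eps_cvg _ LP).
have xk : x k = xp (eps k) by near: k.
rewrite (contr k).2 sub0r normrN in dk.
rewrite gt0 subr0 in Ck.
apply: (le_trans dk); apply: (le_trans Ck).
rewrite -mulrA ler_pM2l// -exprMn xk hxp_xt.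
by rewrite lerXn2r// nnegrE// mulr_ge0// ltW.
Unshelve. all: by end_near. Qed.
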